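(* Let $A$ be a commutative $\mathbf{k}$-algebra, regarded as a Rota-Baxter $\mathbf{k}$-algebra of weight zero with the zero Rota-Baxter operator. Let $S$ be a multiplicative subset of $A$ and let $V$ be the $\mathbf{k}$-module $S^{-1}A/A$, where $A$ is identified with its image in $S^{-1}A$. Then the Rota-Baxter localization $S^{-1}_{RB}A$ of $A$ at $S$, in the category of commutative Rota-Baxter $\mathbf{k}$-algebras of weight zero, is given by $$S^{-1}A\oplus\Big(\bigoplus_{k\ge 1}\big(S^{-1}A\otimes V^{\otimes k}\big)\Big)$$ with the quotient ring structure from $\mathrm{Sha}(S^{-1}A)$. In other words, it is the tensor product algebra $$S^{-1}_{RB}A=S^{-1}A\otimes\Big(\bigoplus_{k\ge 0}V^{\otimes k}\Big),$$ where the second tensor factor is the shuffle product algebra on $V$. (Here ''given by'' means that this algebra carries a Rota-Baxter operator of weight zero with which, together with the canonical map from $A$ into the component $S^{-1}A$, it is the Rota-Baxter localization.)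
   Context: $\mathbf{k}$ is a commutative unitary ring and all algebras are commutative unital $\mathbf{k}$-algebras. A Rota-Baxter algebra of weight zero is a pair $(R,P)$ with $R$ an algebra and $P:R\to R$ a $\mathbf{k}$-linear map satisfying $P(x)P(y)=P(xP(y)+P(x)y)$ for all $x,y\in R$. A morphism $f:(R,P)\to(R',P')$ is an algebra homomorphism with $f\circ P=P'\circ f$. $S^{-1}A$ denotes the usual localization, and tensor products are over $\mathbf{k}$. Rota-Baxter localization (in weight zero): for a multiplicative subset $S\subseteq R$, it is a commutative Rota-Baxter algebra $(S^{-1}_{RB}R,S^{-1}P)$ of weight zero with a Rota-Baxter homomorphism $i_S:R\to S^{-1}_{RB}R$ such that (1) the elements of $i_S(S)$ are invertible; (2) for every commutative Rota-Baxter algebra $(R',P_{R'})$ of weight zero and Rota-Baxter homomorphism $f:R\to R'$ such that $f(S)$ consists of invertible elements, there is a unique Rota-Baxter homomorphism $f_S:S^{-1}_{RB}R\to R'$ with $f_S\circ i_S=f$. For a commutative algebra $B$, $\mathrm{Sha}(B)=\bigoplus_{k\ge 1}B^{\otimes k}$ is the free commutative Rota-Baxter algebra of weight zero on $B$, with product $$(a_0\otimes a_1\otimes\cdots\otimes a_m)\diamond(b_0\otimes b_1\otimes\cdots\otimes b_n)=(a_0b_0)\otimes\big((a_1\otimes\cdots\otimes a_m)\ \text{shuffled with}\ (b_1\otimes\cdots\otimes b_n)\big)$$ and operator $x\mapsto 1\otimes x$. Here the shuffle product of two pure tensors of lengths $m,n$ is the sum over all $(m,n)$-shuffles of the $m+n$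 tensor factors. The quotient structure is along the surjection $\mathrm{Sha}(S^{-1}A)\to S^{-1}A\oplus\bigoplus_{k\ge1}(S^{-1}A\otimes V^{\otimes k})$ that applies the quotient map $S^{-1}A\to V$ to every tensor factor except the first. The shuffle product algebra on $V$ is $\bigoplus_{k\ge 0}V^{\otimes k}$ (with $V^{\otimes 0}=\mathbf{k}$) with the shuffle product. *)

(* Defs.v *)
From HB Require Import structures.
From mathcomp Require Import all_boot all_order all_algebra.
From mathcomp Require Import boolp classical_sets functions cardinality fsbigop.
From mathcomp Require Import ring.

Set Implicit Arguments.
Unset Strict Implicit.
Unset Printing Implicit Defensive.

Import GRing.Theory.
Local Open Scope ring_scope.
Local Open Scope classical_set_scope.
Local Open Scope quotient_scope.

Section Span.
Variables (k : comPzRingType) (M : lmodType k).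

Definition submodule (Q : set M) : Prop :=
  Q 0 /\ forall (c : k) (x y : M), Q x -> Q y -> Q (c *: x + y).

Definition span (G : set M) : set M :=
  [set x | forall Q : set M, submodule Q -> G `<=` Q -> Q x].

Lemma span_submodule G : submodule (span G).
Proof.
split=> [Q [] //|c x y sx sy Q sQ GQ].
by apply: (proj2 sQ); [apply: sx|apply: sy].
Qed.

Lemma sub_span G : G `<=` span G.
Proof. by move=> x Gx Q _; apply. Qed.

Definition span_pred (G : set M) : {pred M} := fun x => `[< span G x >].

Lemma span_predP G x : reflect (span G x) (x \in span_pred G).
Proof. exact: asboolP. Qed.

Lemma span_zmod_closed G : zmod_closed (span_pred G).
Proof.
have [s0 sL] := span_submodule G.
split; first exact/span_predP.
move=> x y /span_predP sx /span_predP sy; apply/span_predP.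
by rewrite addrC -scaleN1r; apply: sL.
Qed.

HB.instance Definition _ G :=
  GRing.isZmodClosed.Build M (span_pred G) (span_zmod_closed G).

(* The quotient of M by the submodule generated by G. *)
Definition lquot (G : set M) : Type := Quotient.quot (span_pred G).

HB.instance Definition _ G := GRing.Zmodule.on (lquot G).

Definition lquot_pi (G : set M) (x : M) : lquot G := \pi_(Quotient.quot (span_pred G)) x.
Definition lquot_repr (G : set M) (x : lquot G) : M :=
  repr (x : Quotient.quot (span_pred G)).

Lemma lquot_reprK G : cancel (@lquot_repr G) (lquot_pi G).
Proof. by move=> x; rewrite /lquot_pi reprK. Qed.

Lemma lquot_piD G : {morph lquot_pi G : x y / x + y}.
Proof. by move=> x y; rewrite /lquot_pi [RHS]piE. Qed.

Lemma lquot_piP G x y : lquot_pi G x = lquot_pi G y <-> span G (x - y).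
Proof.
rewrite /lquot_pi; split=> [/eqP|/span_predP]; rewrite -?Quotient.idealrBE.
  by move/span_predP.
by rewrite Quotient.idealrBE => /eqP.
Qed.

Definition lquot_scale (G : set M) (c : k) (x : lquot G) : lquot G :=
  lquot_pi G (c *: lquot_repr x).

Lemma lquot_scale_pi G c x : lquot_scale c (lquot_pi G x) = lquot_pi G (c *: x).
Proof.
apply/lquot_piP; rewrite -scalerBr.
have [s0 sL] := span_submodule G.
rewrite -[X in span _ X]addr0; apply: sL => //.
by apply/lquot_piP; rewrite lquot_reprK.
Qed.

Lemma lquot_scaleA G a b (v : lquot G) :
  lquot_scale a (lquot_scale b v) = lquot_scale (a * b) v.
Proof. by rewrite -(lquot_reprK v) !lquot_scale_pi scalerA. Qed.

Lemma lquot_scale1 G : left_id 1 (@lquot_scale G).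
Proof. by move=> v; rewrite -(lquot_reprK v) !lquot_scale_pi scale1r. Qed.

Lemma lquot_scaleDr G : right_distributive (@lquot_scale G) +%R.
Proof.
move=> a u v; rewrite -(lquot_reprK u) -(lquot_reprK v) -lquot_piD.
by rewrite !lquot_scale_pi -lquot_piD scalerDr.
Qed.

Lemma lquot_scaleDl G (v : lquot G) : {morph (@lquot_scale G)^~ v : a b / a + b}.
Proof.
move=> a b; rewrite -(lquot_reprK v).
by rewrite !lquot_scale_pi -lquot_piD scalerDl.
Qed.

HB.instance Definition _ G := GRing.Zmodule_isLmodule.Build k (lquot G)
  (@lquot_scaleA G) (@lquot_scale1 G) (@lquot_scaleDr G) (@lquot_scaleDl G).

Lemma lquot_pi_linear G : linear (lquot_pi G).
Proof. by move=> c x y; rewrite lquot_piD -lquot_scale_pi. Qed.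

Lemma linear_span_eq (W : lmodType k) (G : set M) (f : M -> W) :
  linear f -> (forall x, G x -> f x = 0) -> forall x, span G x -> f x = 0.
Proof.
move=> fL fG x /(_ [set x | f x = 0]); apply=> //; split=> [|c u v /= fu fv].
  by have := fL (-1) 0 0; rewrite !scaleN1r !addNr.
by rewrite fL fu fv scaler0 addr0.
Qed.
End Span.

Section DirectSum.
Variables (k : comPzRingType) (I : choiceType) (F : I -> lmodType k).

Definition fin_supp (x : forall i, F i) : Prop := finite_set [set i | x i != 0].

Record dsum : Type := Dsum { dsum_fun :> forall i, F i; dsumP : fin_supp dsum_fun }.

Lemma dsum_eqP (x y : dsum) : (forall i, x i = y i) -> x = y.
Proof.
case: x y => [x xP] [y yP] /= exy.
have {}exy : x = y by apply: functional_extensionality_dep.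
by subst y; rewrite (Prop_irrelevance xP yP).
Qed.

HB.instance Definition _ := gen_eqMixin dsum.
HB.instance Definition _ := gen_choiceMixin dsum.

Lemma fin_supp0 : fin_supp (fun=> 0).
Proof.
rewrite /fin_supp (_ : [set _ | _] = set0) //.
by apply/seteqP; split=> // i /=; rewrite eqxx.
Qed.

Lemma fin_suppD (x y : dsum) : fin_supp (fun i => x i + y i).
Proof.
have fU : finite_set ([set i | x i != 0] `|` [set i | y i != 0]).
  by rewrite finite_setU; split; apply: dsumP.
apply: sub_finite_set fU => i /=.
by have [->|] := eqVneq (x i) 0; [rewrite add0r; right|left].
Qed.

Lemma fin_suppZ (c : k) (x : dsum) : fin_supp (fun i => c *: x i).
Proof.
apply: sub_finite_set (dsumP x) => i /=.
by apply: contraNneq => ->; rewrite scaler0.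
Qed.

Lemma fin_suppN (x : dsum) : fin_supp (fun i => - x i).
Proof. by apply: sub_finite_set (dsumP x) => i /=; rewrite oppr_eq0. Qed.

Definition dsum_zero := Dsum fin_supp0.
Definition dsum_add x y := Dsum (fin_suppD x y).
Definition dsum_opp x := Dsum (fin_suppN x).
Definition dsum_scale c x := Dsum (fin_suppZ c x).

Lemma dsum_addA : associative dsum_add.
Proof. by move=> x y z; apply: dsum_eqP => i /=; rewrite addrA. Qed.
Lemma dsum_addC : commutative dsum_add.
Proof. by move=> x y; apply: dsum_eqP => i /=; rewrite addrC. Qed.
Lemma dsum_add0 : left_id dsum_zero dsum_add.
Proof. by move=> x; apply: dsum_eqP => i /=; rewrite add0r. Qed.
Lemma dsum_addN : left_inverse dsum_zero dsum_opp dsum_add.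
Proof. by move=> x; apply: dsum_eqP => i /=; rewrite addNr. Qed.

HB.instance Definition _ :=
  GRing.isZmodule.Build dsum dsum_addA dsum_addC dsum_add0 dsum_addN.

Lemma dsum_scaleA a b v : dsum_scale a (dsum_scale b v) = dsum_scale (a * b) v.
Proof. by apply: dsum_eqP => i /=; rewrite scalerA. Qed.
Lemma dsum_scale1 : left_id 1 dsum_scale.
Proof. by move=> v; apply: dsum_eqP => i /=; rewrite scale1r. Qed.
Lemma dsum_scaleDr : right_distributive dsum_scale +%R.
Proof. by move=> a u v; apply: dsum_eqP => i /=; rewrite scalerDr. Qed.
Lemma dsum_scaleDl v : {morph dsum_scale^~ v : a b / a + b}.
Proof. by move=> a b; apply: dsum_eqP => i /=; rewrite scalerDl. Qed.

HB.instance Definition _ := GRing.Zmodule_isLmodule.Build k dsum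
  dsum_scaleA dsum_scale1 dsum_scaleDr dsum_scaleDl.

Definition dinj_fun i (v : F i) (j : I) : F j :=
  if i =P j is ReflectT e then ecast j (F j) e v else 0.

Lemma dinj_fun_id i (v : F i) : dinj_fun v i = v.
Proof. by rewrite /dinj_fun; case: eqP => // e; rewrite eq_axiomK. Qed.

Lemma dinj_fun_neq i (v : F i) j : i <> j -> dinj_fun v j = 0.
Proof. by rewrite /dinj_fun; case: eqP. Qed.

Lemma dinj_supp i (v : F i) : fin_supp (dinj_fun v).
Proof.
apply: sub_finite_set (finite_set1 i) => j /=.
by apply: contra_neqP => /nesym/dinj_fun_neq.
Qed.

Definition dinj i (v : F i) : dsum := Dsum (dinj_supp v).

Lemma dinj_linear i : linear (@dinj i).
Proof.
move=> c u v; apply: dsum_eqP => j /=; have [<-|ne] := pselect (i = j).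
  by rewrite !dinj_fun_id.
by rewrite !dinj_fun_neq // scaler0 addr0.
Qed.

(* The map dsum -> W induced by a family of linear maps f i : F i -> W. *)
Definition dlift (W : lmodType k) (f : forall i, F i -> W) (x : dsum) : W :=
  \sum_(i \in [set: I]) f i (x i).

Lemma lin0 (U W : lmodType k) (f : U -> W) : linear f -> f 0 = 0.
Proof. by move=> fL; have := fL (-1) 0 0; rewrite !scaleN1r !addNr. Qed.

Section DLift.
Variables (W : lmodType k) (f : forall i, F i -> W).
Arguments f : clear implicits.
Hypothesis fL : forall i, linear (f i).

Lemma dlift_on (D : set I) (x : dsum) : (forall i, x i != 0 -> D i) ->
  dlift f x = \sum_(i \in D) f i (x i).
Proof.
move=> xD; symmetry; apply: fsbig_widen => // i [_ /= nD].
have [->|/xD//] := eqVneq (x i) 0; exact: lin0.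
Qed.

Lemma dlift_linear : linear (dlift f).
Proof.
move=> c x y; pose D := [set i | x i != 0] `|` [set i | y i != 0].
have Df : finite_set D by rewrite finite_setU; split; apply: dsumP.
have xD i : x i != 0 -> D i by left.
have yD i : y i != 0 -> D i by right.
have zD i : (c *: x + y) i != 0 -> D i.
  rewrite /D /=; have [->|] := eqVneq (x i) 0; last by left.
  by rewrite scaler0 add0r; right.
rewrite (dlift_on zD) (dlift_on xD) (dlift_on yD).
rewrite !fsbig_finite //= scaler_sumr -big_split /=.
by apply: eq_bigr => i _; rewrite fL.
Qed.

Lemma dlift_inj i (v : F i) : dlift f (dinj v) = f i v.
Proof.
rewrite (@dlift_on [set i]) ?fsbig_set1 /= ?dinj_fun_id // => j /=.
by apply: contra_neqP => /nesym/dinj_fun_neq.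
Qed.
End DLift.

Lemma dsum_ext (W : lmodType k) (f g : dsum -> W) : linear f -> linear g ->
  (forall i (v : F i), f (dinj v) = g (dinj v)) -> f =1 g.
Proof.
move=> fL gL fg x.
have [s xs] : exists s : seq I, forall i, x i != 0 -> i \in s.
  by have /finite_seqP[s e] := dsumP x; exists s => i xi; have : [set` s] i by rewrite -e.
elim: s x xs => [|i s IHs] x xs.
  have -> : x = 0.
    by apply: dsum_eqP => i; apply/eqP; apply: contraT => /xs.
  by rewrite !lin0.
have -> : x = 1 *: dinj (x i) + (x - dinj (x i)) by rewrite scale1r addrC subrK.
rewrite fL gL fg IHs // => j /=; have [<-|ne] := pselect (i = j).
  by rewrite dinj_fun_id subrr eqxx.
rewrite dinj_fun_neq // oppr0 addr0 => /xs.
by rewrite inE => /orP[/eqP/esym|].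
Qed.
End DirectSum.

Section Tensor.
Variables (k : comPzRingType) (M N : lmodType k).

(* The free module on the set M * N. *)
Definition tens_free : lmodType k := dsum (fun _ : M * N => k^o : lmodType k).

Definition tens_gen (m : M) (n : N) : tens_free :=
  dinj (F := fun _ : M * N => k^o : lmodType k) (i := (m, n)) (1 : k^o).

Definition tens_rel : set tens_free :=
  [set r | exists (c : k) (m m' : M) (n : N),
     r = tens_gen (c *: m + m') n - (c *: tens_gen m n + tens_gen m' n)] `|`
  [set r | exists (c : k) (m : M) (n n' : N),
     r = tens_gen m (c *: n + n') - (c *: tens_gen m n + tens_gen m n')].

Definition tens : lmodType k := lquot tens_rel.

Definition tpure (m : M) (n : N) : tens := lquot_pi tens_rel (tens_gen m n).

Lemma tpure_linl n : linear (tpure^~ n).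
Proof.
move=> c m m'; rewrite /tpure -lquot_pi_linear; apply/lquot_piP.
by apply: sub_span; left; exists c, m, m', n.
Qed.

Lemma tpure_linr m : linear (tpure m).
Proof.
move=> c n n'; rewrite /tpure -lquot_pi_linear; apply/lquot_piP.
by apply: sub_span; right; exists c, m, n, n'.
Qed.

(* The linear map tens -> W induced by a bilinear map f. *)
Definition tlift (W : lmodType k) (f : M -> N -> W) (t : tens) : W :=
  dlift (fun (p : M * N) (c : k^o) => (c : k) *: f p.1 p.2) (lquot_repr t).

Section TLift.
Variables (W : lmodType k) (f : M -> N -> W).
Hypotheses (fl : forall n, linear (f^~ n)) (fr : forall m, linear (f m)).

Let f' := dlift (fun (p : M * N) (c : k^o) => (c : k) *: f p.1 p.2).

Let f'L : linear f'.
Proof.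
apply: dlift_linear => p c u v /=.
by rewrite scalerDl scalerA.
Qed.

Let f'gen m n : f' (tens_gen m n) = f m n.
Proof.
rewrite /f' /tens_gen dlift_inj ?scale1r // => p c u v /=.
by rewrite scalerDl scalerA.
Qed.

Let f'B x y : f' (x - y) = f' x - f' y.
Proof. by have := f'L (-1) y x; rewrite !scaleN1r ![- _ + _]addrC. Qed.

Let f'pi x : tlift f (lquot_pi tens_rel x) = f' x.
Proof.
have /lquot_piP : lquot_pi tens_rel (lquot_repr (lquot_pi tens_rel x)) = lquot_pi tens_rel x.
  exact: lquot_reprK.
move/(linear_span_eq f'L) => h; apply/eqP; rewrite -subr_eq0 -f'B; apply/eqP.
apply: h => _ [] [c [u [v [w ->]]]]; rewrite f'B f'L !f'gen.
  by rewrite fl subrr.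
by rewrite fr subrr.
Qed.

Lemma tlift_linear : linear (tlift f).
Proof.
move=> c x y; rewrite -(lquot_reprK x) -(lquot_reprK y) -lquot_pi_linear.
by rewrite !f'pi f'L.
Qed.

Lemma tlift_pure m n : tlift f (tpure m n) = f m n.
Proof. by rewrite /tpure f'pi f'gen. Qed.
End TLift.

Lemma tens_ext (W : lmodType k) (f g : tens -> W) : linear f -> linear g ->
  (forall m n, f (tpure m n) = g (tpure m n)) -> f =1 g.
Proof.
move=> fL gL fg x; rewrite -(lquot_reprK x).
suff h : f \o lquot_pi tens_rel =1 g \o lquot_pi tens_rel by exact: h.
apply: dsum_ext.
- by move=> c u v /=; rewrite lquot_pi_linear; exact: fL.
- by move=> c u v /=; rewrite lquot_pi_linear; exact: gL.
move=> [m n] c /=.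
have dinjL := @dinj_linear _ _ (fun _ : M * N => k^o : lmodType k) (m, n).
have -> : dinj (c : (fun _ : M * N => k^o : lmodType k) (m, n)) =
    c *: tens_gen m n + dinj (0 : (fun _ : M * N => k^o : lmodType k) (m, n)).
  rewrite /tens_gen -dinjL; congr dinj.
  by rewrite addr0 /GRing.scale /= mulr1.
have z0 := lin0 dinjL.
rewrite z0 !lquot_pi_linear fL gL (lin0 (@lquot_pi_linear _ _ _)).
by rewrite (lin0 fL) (lin0 gL) -/(tpure m n) fg.
Qed.
End Tensor.

Section TensorPower.
Variables (k : comPzRingType) (V : lmodType k).

Fixpoint tpow1 (n : nat) : lmodType k :=
  if n is m.+1 then tens V (tpow1 m) else V.

(* V^(x)n, with V^(x)0 = k and V^(x)1 = V on the nose. *)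
Definition tpow (n : nat) : lmodType k :=
  if n is m.+1 then tpow1 m else (k^o : lmodType k).

(* B (x) V^(x)n, with B itself for n = 0; mtens B B n is B^(x)(n+1). *)
Definition mtens (B : lmodType k) (n : nat) : lmodType k :=
  if n is m.+1 then tens B (tpow m.+1) else B.
End TensorPower.

Section Shuffles.
Variable T : Type.

(* The list, with multiplicities, of the shuffles of two words. *)
Fixpoint shuffles (s : seq T) : seq T -> seq (seq T) :=
  if s is x :: s' then
    fix shuffles_s t :=
      if t is y :: t' then
        [seq x :: w | w <- shuffles s' t] ++ [seq y :: w | w <- shuffles_s t']
      else [:: s]
  else fun t => [:: t].

Lemma shuffles0 s : shuffles s [::] = [:: s].
Proof. by case: s. Qed.

Variable W : nmodType.
Implicit Types Phi : seq T -> W.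

Definition shsum Phi s t : W := \sum_(w <- shuffles s t) Phi w.

Lemma shsum0s Phi t : shsum Phi [::] t = Phi t.
Proof. by rewrite /shsum big_seq1. Qed.

Lemma shsums0 Phi s : shsum Phi s [::] = Phi s.
Proof. by rewrite /shsum shuffles0 big_seq1. Qed.

Lemma shsum_cons Phi x s y t : shsum Phi (x :: s) (y :: t) =
  shsum (fun w => Phi (x :: w)) s (y :: t) +
  shsum (fun w => Phi (y :: w)) (x :: s) t.
Proof. by rewrite /shsum /= big_cat /= !big_map. Qed.

Lemma shsumC Phi s t : shsum Phi s t = shsum Phi t s.
Proof.
elim: s t Phi => [|x s IHs] t Phi; first by rewrite shsum0s shsums0.
elim: t Phi => [|y t IHt] Phi; first by rewrite shsum0s shsums0.
by rewrite !shsum_cons IHs IHt addrC.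
Qed.

Lemma eq_shsum f g s t : f =1 g -> shsum f s t = shsum g s t.
Proof. by move=> fg; apply: eq_bigr => w _; apply: fg. Qed.

Lemma shsumD f g s t :
  shsum (fun w => f w + g w) s t = shsum f s t + shsum g s t.
Proof. by rewrite /shsum big_split. Qed.

Lemma shsumA Phi s t r :
  shsum (fun w => shsum Phi w r) s t = shsum (fun w => shsum Phi s w) t r.
Proof.
elim: s t r Phi => [|x s IHs] t r Phi.
  by rewrite shsum0s; apply: eq_shsum => w; rewrite shsum0s.
elim: t r Phi => [|y t IHt] r Phi; first by rewrite shsums0 shsum0s.
elim: r Phi => [|z r IHr] Phi.
  by rewrite !shsums0; apply: eq_shsum => w; rewrite shsums0.
pose Px w := Phi (x :: w); pose Py w := Phi (y :: w); pose Pz w := Phi (z :: w).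
transitivity (shsum (fun w => shsum Px w (z :: r)) s (y :: t) +
    shsum (fun w => shsum Py w (z :: r)) (x :: s) t +
    shsum (fun w => shsum Pz w r) (x :: s) (y :: t)).
  rewrite [LHS]shsum_cons.
  under eq_shsum => w do rewrite shsum_cons.
  under [X in _ + X]eq_shsum => w do rewrite shsum_cons.
  by rewrite !shsumD addrACA -(shsum_cons (fun w => shsum Pz w r)).
rewrite IHs IHt IHr [RHS]shsum_cons.
under [X in _ = X + _]eq_shsum => w do rewrite shsum_cons.
under [X in _ = _ + X]eq_shsum => w do rewrite shsum_cons.
rewrite !shsumD [RHS]addrACA -[LHS]addrA; congr (_ + _).
exact: shsum_cons.
Qed.
End Shuffles.

Section WordLift.
Variables (k : comPzRingType) (V : lmodType k).

(* Multilinearity in the letters of a word. *)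
Definition mlin (W : lmodType k) (Phi : seq V -> W) : Prop :=
  forall u (c : k) (x y : V) w,
    Phi (u ++ (c *: x + y) :: w) = c *: Phi (u ++ x :: w) + Phi (u ++ y :: w).

Definition mlin2 (B W : lmodType k) (Phi : B -> seq V -> W) : Prop :=
  (forall u, linear (Phi^~ u)) /\ (forall b, mlin (Phi b)).

Lemma mlin_cons (W : lmodType k) (Phi : seq V -> W) :
  mlin Phi -> mlin2 (fun v u => Phi (v :: u)).
Proof.
move=> h; split=> [u c x y|b u c x y w]; first exact: (h [::]).
exact: (h (b :: u)).
Qed.

Lemma mlin_cons1 (W : lmodType k) (Phi : seq V -> W) v :
  mlin Phi -> mlin (fun u => Phi (v :: u)).
Proof. by move/mlin_cons=> [_ h]; exact: h. Qed.

Lemma shsum_mlinl (W : lmodType k) (Phi : seq V -> W) v :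
  mlin Phi -> mlin (fun u => shsum Phi u v).
Proof.
move=> h u c x y w; elim: u v Phi h => [|a u IHu] v Phi h.
  rewrite !cat0s; elim: v Phi h => [|b v IHv] Phi h; first by rewrite !shsums0; exact: (h [::]).
  rewrite !shsum_cons (IHv (fun w => Phi (b :: w))); last exact: mlin_cons1.
  rewrite scalerDr addrACA; congr (_ + _).
  rewrite /shsum scaler_sumr -big_split; apply: eq_bigr => z _; exact: (h [::]).
rewrite !cat_cons; elim: v Phi h => [|b v IHv] Phi h.
  by rewrite !shsums0 -!cat_cons h.
rewrite !shsum_cons IHu; last exact: mlin_cons1.
rewrite (IHv (fun w => Phi (b :: w))); last exact: mlin_cons1.
by rewrite scalerDr addrACA.
Qed.

Lemma shsum_mlinr (W : lmodType k) (Phi : seq V -> W) u :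
  mlin Phi -> mlin (shsum Phi u).
Proof. by move=> h s c x y w; rewrite !(shsumC _ u) (shsum_mlinl _ h). Qed.

Lemma tlift_comb (M N W : lmodType k) (f g : M -> N -> W) (c : k) t :
  tlift (fun m n => c *: f m n + g m n) t = c *: tlift f t + tlift g t.
Proof.
rewrite /tlift; set x := lquot_repr t; pose D := [set i | x i != 0].
have Df : finite_set D by exact: dsumP.
have E (h : M -> N -> W) : dlift (fun p (a : k^o) => (a : k) *: h p.1 p.2) x =
    \sum_(i \in D) (x i : k) *: h i.1 i.2.
  by apply: dlift_on => // p a y z /=; rewrite scalerDl scalerA.
rewrite (E (fun m n => c *: f m n + g m n)) (E f) (E g) !fsbig_finite //= scaler_sumr -big_split /=.
by apply: eq_bigr => i _; rewrite scalerDr !scalerA mulrC.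
Qed.

(* The map on tensor powers induced by a multilinear map on words; it is     *)
(* applied only to words of length n.                                         *)
Fixpoint tpow1_lift (W : lmodType k) (n : nat) (Phi : V -> seq V -> W) :
    tpow1 V n -> W :=
  if n is m.+1 return tpow1 V n -> W then
    tlift (fun v => tpow1_lift (n := m) (fun v' u => Phi v (v' :: u)))
  else Phi^~ [::].

Definition tpow_lift (W : lmodType k) (Phi : seq V -> W) (n : nat) :
    tpow V n -> W :=
  if n is m.+1 return tpow V n -> W then tpow1_lift (n := m) (fun v u => Phi (v :: u))
  else fun c : k^o => (c : k) *: Phi [::].

Definition mtens_lift (B W : lmodType k) (Phi : B -> seq V -> W) (n : nat) :
    mtens V B n -> W :=
  if n is m.+1 return mtens V B n -> W then
    tlift (fun b => tpow1_lift (n := m) (fun v u => Phi b (v :: u)))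
  else Phi^~ [::].

Lemma tpow1_lift_comb (W : lmodType k) n (f g : V -> seq V -> W) (c : k) t :
  tpow1_lift (n := n) (fun v u => c *: f v u + g v u) t =
  c *: tpow1_lift (n := n) f t + tpow1_lift (n := n) g t.
Proof.
elim: n f g t => [//|n IHn] f g t /=.
rewrite -tlift_comb; congr tlift; apply: functional_extensionality_dep => v.
by apply: functional_extensionality_dep => s; rewrite -IHn.
Qed.

Lemma mlin2_cons (B W : lmodType k) (Phi : B -> seq V -> W) b :
  mlin2 Phi -> mlin2 (fun v u => Phi b (v :: u)).
Proof. by case=> _ h; exact: mlin_cons. Qed.

Lemma tpow1_lift_linearl (B W : lmodType k) (Phi : B -> seq V -> W) n t :
  mlin2 Phi -> linear (fun b => tpow1_lift (n := n) (fun v u => Phi b (v :: u)) t).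
Proof.
case=> h _ c x y; rewrite -tpow1_lift_comb; congr tpow1_lift.
apply: functional_extensionality_dep => v.
by apply: functional_extensionality_dep => s; exact: h.
Qed.

Lemma tpow1_lift_linear (W : lmodType k) (Phi : V -> seq V -> W) n :
  mlin2 Phi -> linear (tpow1_lift (n := n) Phi).
Proof.
elim: n Phi => [|n IHn] Phi h /=; first by case: h.
apply: tlift_linear => [t|v]; first exact: tpow1_lift_linearl.
by apply: IHn; exact: mlin2_cons.
Qed.

Lemma tpow_lift_linear (W : lmodType k) (Phi : seq V -> W) n :
  mlin Phi -> linear (tpow_lift Phi (n := n)).
Proof.
case: n => [|n] h; first by move=> c x y /=; rewrite scalerDl scalerA.
by apply: tpow1_lift_linear; exact: mlin_cons.
Qed.

Lemma mtens_lift_linear (B W : lmodType k) (Phi : B -> seq V -> W) n :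
  mlin2 Phi -> linear (mtens_lift Phi (n := n)).
Proof.
case: n => [|n] h; first exact: (proj1 h [::]).
apply: tlift_linear => [t|v]; first exact: tpow1_lift_linearl.
by apply: tpow1_lift_linear; exact: mlin2_cons.
Qed.

(* The pure tensor v (x) u_1 (x) ... (x) u_n, where n = size u. *)
Fixpoint tpow1_pure (v : V) (u : seq V) : tpow1 V (size u) :=
  if u is v' :: u' return tpow1 V (size u) then tpure v (tpow1_pure v' u') else v.

Definition tpow_pure (u : seq V) : tpow V (size u) :=
  if u is v :: u' return tpow V (size u) then tpow1_pure v u' else (1 : k^o).

Definition mtens_pure (B : lmodType k) (b : B) (u : seq V) : mtens V B (size u) :=
  if u is v :: u' return mtens V B (size u) then tpure b (tpow1_pure v u') else b.

Lemma tpow1_lift_pure (W : lmodType k) (Phi : V -> seq V -> W) v u :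
  mlin2 Phi -> tpow1_lift Phi (tpow1_pure v u) = Phi v u.
Proof.
elim: u v Phi => [//|v' u IHu] v Phi h /=.
rewrite tlift_pure; first by apply: IHu; exact: mlin2_cons.
  by move=> t; exact: tpow1_lift_linearl.
by move=> b; apply: tpow1_lift_linear; exact: mlin2_cons.
Qed.

Lemma tpow_lift_pure (W : lmodType k) (Phi : seq V -> W) u :
  mlin Phi -> tpow_lift Phi (tpow_pure u) = Phi u.
Proof.
case: u => [|v u] h /=; first by rewrite scale1r.
by apply: tpow1_lift_pure; exact: mlin_cons.
Qed.

Lemma mtens_lift_pure (B W : lmodType k) (Phi : B -> seq V -> W) b u :
  mlin2 Phi -> mtens_lift Phi (mtens_pure b u) = Phi b u.
Proof.
case: u => [//|v u] h /=.
rewrite tlift_pure; first by apply: tpow1_lift_pure; exact: mlin2_cons.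
  by move=> t; exact: tpow1_lift_linearl.
by move=> b'; apply: tpow1_lift_linear; exact: mlin2_cons.
Qed.

Lemma tpow1_ext (W : lmodType k) (f g : forall n, tpow1 V n -> W) :
  (forall n, linear (f n)) -> (forall n, linear (g n)) ->
  (forall v u, f _ (tpow1_pure v u) = g _ (tpow1_pure v u)) ->
  forall n, f n =1 g n.
Proof.
move=> fL gL fg n; elim: n f g fL gL fg => [|n IHn] f g fL gL fg.
  by move=> v; exact: (fg v [::]).
apply: (@tens_ext k V (tpow1 V n) W (f n.+1) (g n.+1) (fL n.+1) (gL n.+1)) => v t.
have := IHn (fun n t => f n.+1 (tpure v t)) (fun n t => g n.+1 (tpure v t)).
apply.
- by move=> m c x y; rewrite tpure_linr fL.
- by move=> m c x y; rewrite tpure_linr gL.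
- by move=> v' u; exact: (fg v (v' :: u)).
Qed.

Lemma tpow1_pure_linear u : linear (tpow1_pure^~ u).
Proof. by case: u => [//|v u]; exact: tpure_linl. Qed.

Lemma tpow1_pure_mlin (W : lmodType k) (f : forall n, tpow1 V n -> W) v :
  (forall n, linear (f n)) -> mlin (fun u => f _ (tpow1_pure v u)).
Proof.
move=> fL u c x y w; elim: u v f fL => [|a u IHu] v f fL /=.
  by rewrite tpow1_pure_linear tpure_linr fL.
apply: (IHu a (fun n t => f n.+1 (tpure v t))) => m d s t.
by rewrite tpure_linr fL.
Qed.
End WordLift.

(* Commutative unital k-algebras; unlike for comAlgType, the zero ring is     *)
(* allowed, as localizations may vanish.                                      *)
Record comPzAlg (k : comPzRingType) := ComPzAlg {
  alg_mod : lmodType k;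
  alg_one : alg_mod;
  alg_mul : alg_mod -> alg_mod -> alg_mod;
  alg_mulA : associative alg_mul;
  alg_mulC : commutative alg_mul;
  alg_mul1 : left_id alg_one alg_mul;
  alg_mul_linear : forall y, linear (alg_mul^~ y)
}.

Definition alg_sort (k : comPzRingType) (B : comPzAlg k) : Type := alg_mod B.
Coercion alg_sort : comPzAlg >-> Sortclass.

Section AlgebraRing.
Variables (k : comPzRingType) (B : comPzAlg k).

HB.instance Definition _ := GRing.Lmodule.on (alg_sort B).

Lemma alg_mulDl : left_distributive (@alg_mul k B) +%R.
Proof. by move=> x y z; have := alg_mul_linear z 1 x y; rewrite !scale1r. Qed.

HB.instance Definition _ := GRing.Zmodule_isComPzRing.Build (alg_sort B)
  (@alg_mulA k B) (@alg_mulC k B) (@alg_mul1 k B) alg_mulDl.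

Lemma alg_scaleAl (c : k) (x y : B) : c *: (x * y) = (c *: x) * y.
Proof.
have /= h := @alg_mul_linear k B y c x (0 : B).
have e : alg_mul (0 : B) y = 0 := mul0r (y : B).
by rewrite e !addr0 in h; exact: esym h.
Qed.

Lemma alg_scaleAr (c : k) (x y : B) : c *: (x * y) = x * (c *: y).
Proof. by rewrite mulrC alg_scaleAl mulrC. Qed.

Lemma alg_linl (y : B) : linear (fun x : B => x * y).
Proof. exact: (@alg_mul_linear k B). Qed.

Lemma alg_linr (x : B) : linear (fun y : B => x * y).
Proof. by move=> c y z; rewrite mulrDr alg_scaleAr. Qed.
End AlgebraRing.

Lemma lin_sum (k : comPzRingType) (U W : lmodType k) (f : U -> W) (T : Type) (r : seq T) (F : T -> U) :
  linear f -> f (\sum_(i <- r) F i) = \sum_(i <- r) f (F i).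
Proof.
move=> fL; elim: r => [|i r IHr]; first by rewrite !big_nil (lin0 fL).
by rewrite !big_cons -[F i]scale1r fL IHr !scale1r.
Qed.

Section BilinearProduct.
Variables (k : comPzRingType) (M : lmodType k) (X : Type) (gen : X -> M).
Hypothesis gen_ext : forall f g : M -> M, linear f -> linear g ->
  (forall x, f (gen x) = g (gen x)) -> f =1 g.
Variables (one : M) (mul : M -> M -> M).
Hypothesis mul_linl : forall y, linear (mul^~ y).
Hypothesis mul_gen_linr : forall x, linear (mul (gen x)).

Lemma linear_comb (f g : M -> M) (c : k) :
  linear f -> linear g -> linear (fun x => c *: f x + g x).
Proof.
move=> fL gL a x y; rewrite fL gL !scalerDr !scalerA mulrC.
by rewrite addrACA.
Qed.

Lemma bil_linr x : linear (mul x).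
Proof.
move=> c y z; have /= := gen_ext (f := mul^~ (c *: y + z))
  (g := fun x => c *: mul x y + mul x z).
apply; [exact: mul_linl | by apply: linear_comb; exact: mul_linl |].
by move=> t; exact: mul_gen_linr.
Qed.

Lemma bil_mul1 : (forall x, mul one (gen x) = gen x) -> left_id one mul.
Proof.
by move=> h y; have /= := gen_ext (f := mul one) (g := id); apply => //; exact: bil_linr.
Qed.

Lemma bil_mulC : (forall x y, mul (gen x) (gen y) = mul (gen y) (gen x)) ->
  commutative mul.
Proof.
move=> h x y; have /= := gen_ext (f := mul x) (g := mul^~ x).
apply; [exact: bil_linr | exact: mul_linl | move=> v].
have /= := gen_ext (f := mul^~ (gen v)) (g := mul (gen v)).
by apply=> //; exact: bil_linr.
Qed.

Lemma bil_mulA :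
  (forall x y z, mul (gen x) (mul (gen y) (gen z)) =
                 mul (mul (gen x) (gen y)) (gen z)) -> associative mul.
Proof.
have L2 a b : linear (fun z => mul a (mul b z)).
  by move=> c u v; rewrite bil_linr (bil_linr a).
have L3 a b : linear (fun z => mul a (mul z b)).
  by move=> c u v; rewrite mul_linl (bil_linr a).
have L4 a b : linear (fun z => mul (mul a z) b).
  by move=> c u v; rewrite bil_linr mul_linl.
have L5 a b : linear (fun z => mul (mul z a) b).
  by move=> c u v; rewrite !mul_linl.
move=> h x y z.
have /= := gen_ext (f := fun z => mul x (mul y z)) (g := mul (mul x y)).
apply=> [||{}z]; [exact: L2 | exact: bil_linr |].
have /= := gen_ext (f := fun y => mul x (mul y (gen z)))
  (g := fun y => mul (mul x y) (gen z)).
apply=> [||{}y]; [exact: L3 | exact: L4 |].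
have /= := gen_ext (f := fun x => mul x (mul (gen y) (gen z)))
  (g := fun x => mul (mul x (gen y)) (gen z)).
by apply=> [||{}x]; [exact: mul_linl | exact: L5 | exact: h].
Qed.
End BilinearProduct.

Section ShuffleAlgebra.
Variables (k : comPzRingType) (V : lmodType k).

Definition shuf_mod : lmodType k := dsum (tpow V).

Definition spure (u : seq V) : shuf_mod := dinj (tpow_pure u).

Definition slift (W : lmodType k) (Phi : seq V -> W) : shuf_mod -> W :=
  dlift (tpow_lift Phi).

Lemma slift_linear (W : lmodType k) (Phi : seq V -> W) :
  mlin Phi -> linear (slift Phi).
Proof. by move=> h; apply: dlift_linear => n; exact: tpow_lift_linear. Qed.

Lemma slift_pure (W : lmodType k) (Phi : seq V -> W) u :
  mlin Phi -> slift Phi (spure u) = Phi u.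
Proof.
move=> h; rewrite /slift dlift_inj; last by move=> n; exact: tpow_lift_linear.
exact: tpow_lift_pure.
Qed.

Lemma shuf_ext (W : lmodType k) (f g : shuf_mod -> W) : linear f -> linear g ->
  (forall u, f (spure u) = g (spure u)) -> f =1 g.
Proof.
move=> fL gL fg; apply: dsum_ext => // -[|n] v.
  have vE : v = v *: (1 : k^o) + 0 by rewrite addr0 /GRing.scale /= mulr1.
  rewrite vE !dinj_linear fL gL (lin0 (@dinj_linear _ _ (tpow V) 0)).
  by rewrite (lin0 fL) (lin0 gL); congr (_ *: _ + _); exact: (fg [::]).
apply: (tpow1_ext (f := fun n t => f (dinj (t : tpow V n.+1)))
                  (g := fun n t => g (dinj (t : tpow V n.+1)))).
- by move=> m c x y; rewrite dinj_linear fL.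
- by move=> m c x y; rewrite dinj_linear gL.
- by move=> x u; exact: (fg (x :: u)).
Qed.

Lemma spure_mlin : mlin spure.
Proof.
case=> [|v u] c x y w; rewrite ?cat0s ?cat_cons.
  by rewrite /spure /= tpow1_pure_linear dinj_linear.
apply: (tpow1_pure_mlin (f := fun n t => dinj (t : tpow V n.+1) : shuf_mod)).
by move=> n; exact: (@dinj_linear _ _ (tpow V) n.+1).
Qed.

Definition shuf_mul (x y : shuf_mod) : shuf_mod :=
  slift (fun u => slift (fun v => shsum spure u v) y) x.

Lemma shuf_mul_mlin y : mlin (fun u => slift (fun v => shsum spure u v) y).
Proof.
move=> u c a b w.
have mr s : mlin (shsum spure s) by apply: shsum_mlinr; exact: spure_mlin.
have := shuf_ext (f := slift (shsum spure (u ++ (c *: a + b) :: w)))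
  (g := fun y => c *: slift (shsum spure (u ++ a :: w)) y +
                 slift (shsum spure (u ++ b :: w)) y).
apply; [exact: slift_linear | by apply: linear_comb; exact: slift_linear |].
by move=> v; rewrite !slift_pure // shsum_mlinl //; exact: spure_mlin.
Qed.

Lemma shuf_mul_linl y : linear (shuf_mul^~ y).
Proof. by apply: slift_linear; exact: shuf_mul_mlin. Qed.

Lemma shuf_mul_pure u v :
  shuf_mul (spure u) (spure v) = \sum_(w <- shuffles u v) spure w.
Proof.
rewrite /shuf_mul slift_pure; last exact: shuf_mul_mlin.
by rewrite slift_pure //; apply: shsum_mlinr; exact: spure_mlin.
Qed.

Lemma shuf_mul_pure_linr u : linear (shuf_mul (spure u)).
Proof.
move=> c x y; rewrite /shuf_mul !slift_pure; try exact: shuf_mul_mlin.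
by rewrite slift_linear //; apply: shsum_mlinr; exact: spure_mlin.
Qed.

Let shuf_gen_ext := @shuf_ext shuf_mod.

Lemma shuf_mulA : associative shuf_mul.
Proof.
apply: (bil_mulA shuf_gen_ext shuf_mul_linl shuf_mul_pure_linr) => u v w.
rewrite !shuf_mul_pure (lin_sum _ _ (shuf_mul_pure_linr u)).
rewrite (lin_sum _ _ (shuf_mul_linl (spure w))).
under eq_bigr => z _ do rewrite shuf_mul_pure.
under [RHS]eq_bigr => z _ do rewrite shuf_mul_pure.
by symmetry; exact: shsumA.
Qed.

Lemma shuf_mulC : commutative shuf_mul.
Proof.
apply: (bil_mulC shuf_gen_ext shuf_mul_linl shuf_mul_pure_linr) => u v.
by rewrite !shuf_mul_pure; exact: shsumC.
Qed.

Lemma shuf_mul1 : left_id (spure [::]) shuf_mul.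
Proof.
apply: (bil_mul1 shuf_gen_ext shuf_mul_linl shuf_mul_pure_linr) => u.
by rewrite shuf_mul_pure; exact: shsum0s.
Qed.

(* The shuffle product algebra; shuf_mul_pure is the product formula. *)
Definition shuf : comPzAlg k :=
  ComPzAlg shuf_mulA shuf_mulC shuf_mul1 shuf_mul_linl.
End ShuffleAlgebra.

Section ShaAlgebra.
Variables (k : comPzRingType) (B : comPzAlg k) (V : lmodType k).

(* B + sum_(n >= 1) B (x) V^(x)n. *)
Definition sha_mod : lmodType k := dsum (mtens V (B : lmodType k)).

(* The pure tensor b (x) u_1 (x) ... (x) u_n, in the component of index n. *)
Definition wpure (b : B) (u : seq V) : sha_mod :=
  dinj (mtens_pure (B := B : lmodType k) b u).

Definition wlift (W : lmodType k) (Phi : B -> seq V -> W) : sha_mod -> W :=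
  dlift (mtens_lift Phi).

Lemma wlift_linear (W : lmodType k) (Phi : B -> seq V -> W) :
  mlin2 Phi -> linear (wlift Phi).
Proof. by move=> h; apply: dlift_linear => n; exact: mtens_lift_linear. Qed.

Lemma wlift_pure (W : lmodType k) (Phi : B -> seq V -> W) b u :
  mlin2 Phi -> wlift Phi (wpure b u) = Phi b u.
Proof.
move=> h; rewrite /wlift dlift_inj; last by move=> n; exact: mtens_lift_linear.
exact: mtens_lift_pure.
Qed.

Lemma sha_ext (W : lmodType k) (f g : sha_mod -> W) : linear f -> linear g ->
  (forall b u, f (wpure b u) = g (wpure b u)) -> f =1 g.
Proof.
move=> fL gL fg; apply: dsum_ext => // -[|n] v; first exact: (fg v [::]).
have dL := @dinj_linear _ _ (mtens V (B : lmodType k)) n.+1.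
have := @tens_ext _ _ _ W (fun t => f (dinj (t : mtens V (B : lmodType k) n.+1)))
                          (fun t => g (dinj (t : mtens V (B : lmodType k) n.+1))).
apply=> [c x y|c x y|b t]; [by rewrite dL fL | by rewrite dL gL |].
have := tpow1_ext
  (f := fun n t => f (dinj (tpure b t : mtens V (B : lmodType k) n.+1)))
  (g := fun n t => g (dinj (tpure b t : mtens V (B : lmodType k) n.+1))).
apply=> [m c x y|m c x y|x u].
- by rewrite tpure_linr (@dinj_linear _ _ (mtens V (B : lmodType k)) m.+1) fL.
- by rewrite tpure_linr (@dinj_linear _ _ (mtens V (B : lmodType k)) m.+1) gL.
exact: (fg b (x :: u)).
Qed.

Lemma wpure_mlin : mlin2 wpure.
Proof.
split=> [u c x y|b u c x y w].
  rewrite -(@dinj_linear _ _ (mtens V (B : lmodType k))).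
  by case: u => [//|v u]; rewrite /wpure /= tpure_linl.
case: u => [|v u]; rewrite ?cat0s ?cat_cons.
  rewrite -(@dinj_linear _ _ (mtens V (B : lmodType k)) (size w).+1).
  by rewrite /wpure /= tpow1_pure_linear tpure_linr.
have := tpow1_pure_mlin
  (f := fun n t => dinj (tpure b t : mtens V (B : lmodType k) n.+1) : sha_mod).
apply=> n d s t.
by rewrite tpure_linr (@dinj_linear _ _ (mtens V (B : lmodType k)) n.+1).
Qed.

Definition sha_mul (x y : sha_mod) : sha_mod :=
  wlift (fun (b : B) u => wlift (fun (b' : B) v => shsum (wpure (b * b')) u v) y) x.

Let inner_mlin b u : mlin2 (fun (b' : B) v => shsum (wpure (b * b')) u v).
Proof.
have [wl wr] := wpure_mlin; split=> [v c x y|b'].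
  rewrite alg_linr /shsum scaler_sumr -big_split.
  by apply: eq_bigr => w _; exact: wl.
by apply: shsum_mlinr; exact: wr.
Qed.

Lemma sha_mul_mlin y :
  mlin2 (fun (b : B) u => wlift (fun (b' : B) v => shsum (wpure (b * b')) u v) y).
Proof.
have [wl wr] := wpure_mlin; split=> [u c a b|a u c p q w].
  have := sha_ext (f := wlift (fun (b' : B) v => shsum (wpure ((c *: a + b) * b')) u v))
   (g := fun y => c *: wlift (fun (b' : B) v => shsum (wpure (a * b')) u v) y +
                  wlift (fun (b' : B) v => shsum (wpure (b * b')) u v) y).
  apply; [by apply: wlift_linear; exact: inner_mlin
         |by apply: linear_comb; apply: wlift_linear; exact: inner_mlin |].
  move=> b' v; rewrite !wlift_pure; try exact: inner_mlin.
  rewrite (alg_linl b') /shsum scaler_sumr -big_split.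
  by apply: eq_bigr => w _; exact: wl.
have := sha_ext
 (f := wlift (fun (b' : B) v => shsum (wpure (a * b')) (u ++ (c *: p + q) :: w) v))
 (g := fun y => c *: wlift (fun (b' : B) v => shsum (wpure (a * b')) (u ++ p :: w) v) y +
                wlift (fun (b' : B) v => shsum (wpure (a * b')) (u ++ q :: w) v) y).
apply; [by apply: wlift_linear; exact: inner_mlin
       |by apply: linear_comb; apply: wlift_linear; exact: inner_mlin |].
move=> b' v; rewrite !wlift_pure; try exact: inner_mlin.
by rewrite shsum_mlinl //; exact: wr.
Qed.

Lemma sha_mul_linl y : linear (sha_mul^~ y).
Proof. by apply: wlift_linear; exact: sha_mul_mlin. Qed.

Lemma sha_mul_pure a u b v :
  sha_mul (wpure a u) (wpure b v) = \sum_(w <- shuffles u v) wpure (a * b) w.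
Proof.
rewrite /sha_mul wlift_pure; last exact: sha_mul_mlin.
by rewrite wlift_pure //; exact: inner_mlin.
Qed.

Let gen (p : B * seq V) := wpure p.1 p.2.

Let sha_mul_pure_linr p : linear (sha_mul (gen p)).
Proof.
move=> c x y; rewrite /sha_mul !wlift_pure; try exact: sha_mul_mlin.
by rewrite wlift_linear //; exact: inner_mlin.
Qed.

Let sha_gen_ext (f g : sha_mod -> sha_mod) : linear f -> linear g ->
  (forall p, f (gen p) = g (gen p)) -> f =1 g.
Proof. by move=> fL gL fg; apply: sha_ext => // b u; exact: (fg (b, u)). Qed.

Lemma sha_mulA : associative sha_mul.
Proof.
apply: (bil_mulA sha_gen_ext sha_mul_linl sha_mul_pure_linr) => -[a u] [b v] [c w].
rewrite /gen /= !sha_mul_pure (lin_sum _ _ (sha_mul_pure_linr (a, u))).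
rewrite (lin_sum _ _ (sha_mul_linl (wpure c w))) /gen /=.
under eq_bigr => z _ do rewrite sha_mul_pure mulrA.
under [RHS]eq_bigr => z _ do rewrite sha_mul_pure.
by symmetry; exact: shsumA.
Qed.

Lemma sha_mulC : commutative sha_mul.
Proof.
apply: (bil_mulC sha_gen_ext sha_mul_linl sha_mul_pure_linr) => -[a u] [b v].
by rewrite /gen /= !sha_mul_pure mulrC; exact: shsumC.
Qed.

Lemma sha_mul1 : left_id (wpure 1 [::]) sha_mul.
Proof.
apply: (bil_mul1 sha_gen_ext sha_mul_linl sha_mul_pure_linr) => -[a u].
by rewrite /gen /= sha_mul_pure mul1r; exact: shsum0s.
Qed.

(* The product formula is sha_mul_pure. *)
Definition sha : comPzAlg k := ComPzAlg sha_mulA sha_mulC sha_mul1 sha_mul_linl.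
End ShaAlgebra.

(* Sha(B), the sum of the B^(x)n for n >= 1 with the mixable shuffle product. *)
Definition Sha (k : comPzRingType) (B : comPzAlg k) : comPzAlg k :=
  sha B (B : lmodType k).

Section TensorAlgebra.
Variables (k : comPzRingType) (B C : comPzAlg k).

Definition tens_alg_mod : lmodType k := tens (B : lmodType k) (C : lmodType k).

Definition tapure (b : B) (c : C) : tens_alg_mod :=
  tpure (b : (B : lmodType k)) (c : (C : lmodType k)).

Definition tens_mul (x y : tens_alg_mod) : tens_alg_mod :=
  tlift (fun (b : B) (c : C) =>
    tlift (fun (b' : B) (c' : C) => tapure (b * b') (c * c')) y) x.

Let in_l b c (c' : C) : linear (fun b' : B => tapure (b * b') (c * c')).
Proof. by move=> a x y; rewrite alg_linr /tapure tpure_linl. Qed.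

Let in_r b c (b' : B) : linear (fun c' : C => tapure (b * b') (c * c')).
Proof. by move=> a x y; rewrite alg_linr /tapure tpure_linr. Qed.

Let out_l y c : linear (fun b : B =>
  tlift (fun (b' : B) (c' : C) => tapure (b * b') (c * c')) y).
Proof.
move=> a u v; rewrite -tlift_comb; congr (tlift _ y).
apply: functional_extensionality_dep => b'.
apply: functional_extensionality_dep => c'.
by rewrite (alg_linl b') /tapure tpure_linl.
Qed.

Let out_r y b : linear (fun c : C =>
  tlift (fun (b' : B) (c' : C) => tapure (b * b') (c * c')) y).
Proof.
move=> a u v; rewrite -tlift_comb; congr (tlift _ y).
apply: functional_extensionality_dep => b'.
apply: functional_extensionality_dep => c'.
by rewrite (alg_linl c') /tapure tpure_linr.
Qed.

Lemma tens_mul_linl y : linear (tens_mul^~ y).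
Proof. by apply: tlift_linear => ?; [exact: out_l | exact: out_r]. Qed.

Lemma tens_mul_pure b c b' c' :
  tens_mul (tapure b c) (tapure b' c') = tapure (b * b') (c * c').
Proof.
rewrite /tens_mul (tlift_pure (out_l _) (out_r _)).
exact: (tlift_pure (in_l b c) (in_r b c)).
Qed.

Let gen (p : B * C) := tapure p.1 p.2.

Let tens_mul_pure_linr p : linear (tens_mul (gen p)).
Proof.
have E y : tens_mul (gen p) y =
    tlift (fun (b : B) (c : C) => tapure (p.1 * b) (p.2 * c)) y.
  exact: (tlift_pure (out_l y) (out_r y)).
move=> a x y; rewrite !E.
exact: (tlift_linear (in_l p.1 p.2) (in_r p.1 p.2)).
Qed.

Let tens_gen_ext (f g : tens_alg_mod -> tens_alg_mod) : linear f -> linear g ->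
  (forall p, f (gen p) = g (gen p)) -> f =1 g.
Proof. by move=> fL gL fg; apply: tens_ext => // b c; exact: (fg (b, c)). Qed.

Lemma tens_mulA : associative tens_mul.
Proof.
apply: (bil_mulA tens_gen_ext tens_mul_linl tens_mul_pure_linr) => -[a u] [b v] [c w].
by rewrite /gen /= !tens_mul_pure !mulrA.
Qed.

Lemma tens_mulC : commutative tens_mul.
Proof.
apply: (bil_mulC tens_gen_ext tens_mul_linl tens_mul_pure_linr) => -[a u] [b v].
by rewrite /gen /= !tens_mul_pure mulrC [u * v]mulrC.
Qed.

Lemma tens_mul1 : left_id (tapure 1 1) tens_mul.
Proof.
apply: (bil_mul1 tens_gen_ext tens_mul_linl tens_mul_pure_linr) => -[a u].
by rewrite /gen /= tens_mul_pure !mul1r.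
Qed.

Definition tens_alg : comPzAlg k :=
  ComPzAlg tens_mulA tens_mulC tens_mul1 tens_mul_linl.
End TensorAlgebra.

Record multSubset (k : comPzRingType) (A : comPzAlg k) := MultSubset {
  mset : set A;
  mset1 : mset 1;
  msetM : forall s t, mset s -> mset t -> mset (s * t)
}.

Section Localization.
Variables (k : comPzRingType) (A : comPzAlg k) (S : multSubset A).

Record frac := Frac { num : A; den : A; denP : mset S den }.

HB.instance Definition _ := gen_eqMixin frac.
HB.instance Definition _ := gen_choiceMixin frac.

Definition loc_rel (x y : frac) : bool :=
  `[< exists2 t : A, mset S t & t * (num x * den y) = t * (num y * den x) >].

Lemma loc_rel_equiv : equiv_class_of loc_rel.
Proof.
split=> [x|x y|y x z].
- by apply/asboolP; exists 1; [exact: mset1|].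
- by apply/asboolP/asboolP=> -[t St e]; exists t.
move=> /asboolP[t St e] /asboolP[t' St' e']; apply/asboolP.
exists (t * t' * den y); first by do 2?apply: msetM => //; exact: denP.
transitivity (t' * den z * (t * (num x * den y))); first by ring.
rewrite e; transitivity (t * den x * (t' * (num y * den z))); first by ring.
by rewrite e'; ring.
Qed.

Canonical loc_equiv := EquivRelPack loc_rel_equiv.
Canonical loc_encModRel := defaultEncModRel loc_rel.

Definition loc_mod : Type := {eq_quot loc_rel}.
HB.instance Definition _ := Choice.on loc_mod.

Definition mkloc (x : frac) : loc_mod := \pi_({eq_quot loc_rel}) x.
Definition loc_repr (x : loc_mod) : frac := repr (x : {eq_quot loc_rel}).

Lemma loc_reprK : cancel loc_repr mkloc.
Proof. by move=> x; rewrite /mkloc reprK. Qed.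

Lemma mklocP x y :
  mkloc x = mkloc y <-> exists2 t : A, mset S t & t * (num x * den y) = t * (num y * den x).
Proof.
rewrite /mkloc; split=> [/eqP|h].
  by rewrite piE => /asboolP.
by apply/eqP; rewrite piE; apply/asboolP.
Qed.

Definition frac_of (a : A) : frac := Frac a (mset1 S).
Definition frac_add x y : frac :=
  Frac (num x * den y + num y * den x) (msetM (denP x) (denP y)).
Definition frac_mul x y : frac := Frac (num x * num y) (msetM (denP x) (denP y)).
Definition frac_scale (c : k) x : frac := Frac (c *: num x) (denP x).
Definition frac_opp x : frac := Frac (- num x) (denP x).

Definition loc_add x y := mkloc (frac_add (loc_repr x) (loc_repr y)).
Definition loc_mul x y := mkloc (frac_mul (loc_repr x) (loc_repr y)).
Definition loc_scale c x := mkloc (frac_scale c (loc_repr x)).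
Definition loc_opp x := mkloc (frac_opp (loc_repr x)).

Lemma loc_repr_mk x : exists2 t : A, mset S t &
  t * (num (loc_repr (mkloc x)) * den x) = t * (num x * den (loc_repr (mkloc x))).
Proof. by apply/mklocP; rewrite loc_reprK. Qed.

Lemma loc_addE x y : loc_add (mkloc x) (mkloc y) = mkloc (frac_add x y).
Proof.
have [t St e] := loc_repr_mk x; have [s Ss e'] := loc_repr_mk y.
apply/mklocP; exists (t * s); first exact: msetM.
move: e e'; rewrite /=.
set x' := loc_repr _; set y' := loc_repr _ => e e'.
transitivity (t * (num x' * den x) * s * den y' * den y +
              s * (num y' * den y) * t * den x' * den x); first by ring.
by rewrite e e'; ring.
Qed.

Lemma loc_mulE x y : loc_mul (mkloc x) (mkloc y) = mkloc (frac_mul x y).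
Proof.
have [t St e] := loc_repr_mk x; have [s Ss e'] := loc_repr_mk y.
apply/mklocP; exists (t * s); first exact: msetM.
move: e e'; rewrite /=.
set x' := loc_repr _; set y' := loc_repr _ => e e'.
transitivity ((t * (num x' * den x)) * (s * (num y' * den y))); first by ring.
by rewrite e e'; ring.
Qed.

Lemma loc_scaleE c x : loc_scale c (mkloc x) = mkloc (frac_scale c x).
Proof.
have [t St e] := loc_repr_mk x; apply/mklocP; exists t => //=.
by rewrite -!alg_scaleAl -!alg_scaleAr e.
Qed.

Lemma loc_oppE x : loc_opp (mkloc x) = mkloc (frac_opp x).
Proof.
have [t St e] := loc_repr_mk x; apply/mklocP; exists t => //=.
by rewrite !mulNr !mulrN e.
Qed.

Lemma loc_ind (P : loc_mod -> Prop) : (forall x, P (mkloc x)) -> forall x, P x.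
Proof. by move=> h x; rewrite -(loc_reprK x). Qed.

Lemma mkloc_eq x y : num x * den y = num y * den x -> mkloc x = mkloc y.
Proof. by move=> e; apply/mklocP; exists 1; [exact: mset1|rewrite e]. Qed.

Lemma loc_addA : associative loc_add.
Proof.
elim/loc_ind=> x; elim/loc_ind=> y; elim/loc_ind=> z.
by rewrite !loc_addE; apply: mkloc_eq => /=; ring.
Qed.

Lemma loc_addC : commutative loc_add.
Proof.
elim/loc_ind=> x; elim/loc_ind=> y.
by rewrite !loc_addE; apply: mkloc_eq => /=; ring.
Qed.

Lemma loc_add0 : left_id (mkloc (frac_of 0)) loc_add.
Proof. by elim/loc_ind=> x; rewrite loc_addE; apply: mkloc_eq => /=; ring. Qed.

Lemma loc_addN : left_inverse (mkloc (frac_of 0)) loc_opp loc_add.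
Proof.
by elim/loc_ind=> x; rewrite loc_oppE loc_addE; apply: mkloc_eq => /=; ring.
Qed.

HB.instance Definition _ :=
  GRing.isZmodule.Build loc_mod loc_addA loc_addC loc_add0 loc_addN.

Lemma loc_scaleA a b v : loc_scale a (loc_scale b v) = loc_scale (a * b) v.
Proof.
elim/loc_ind: v => x; rewrite !loc_scaleE; apply: mkloc_eq => /=.
by rewrite scalerA.
Qed.

Lemma loc_scale1 : left_id 1 loc_scale.
Proof. by elim/loc_ind=> x; rewrite loc_scaleE; apply: mkloc_eq => /=; rewrite scale1r. Qed.

Lemma loc_scaleDr : right_distributive loc_scale +%R.
Proof.
move=> a; elim/loc_ind=> x; elim/loc_ind=> y.
rewrite [_ + _]loc_addE [RHS]/GRing.add /= !loc_scaleE loc_addE; apply: mkloc_eq => /=.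
by rewrite scalerDr !alg_scaleAl.
Qed.

Lemma loc_scaleDl v : {morph loc_scale^~ v : a b / a + b}.
Proof.
move=> a b; elim/loc_ind: v => x.
rewrite [RHS]/GRing.add /= !loc_scaleE loc_addE; apply: mkloc_eq => /=.
by rewrite -mulrDl -scalerDl mulrA.
Qed.

HB.instance Definition _ := GRing.Zmodule_isLmodule.Build k loc_mod
  loc_scaleA loc_scale1 loc_scaleDr loc_scaleDl.

Lemma loc_mulA : associative loc_mul.
Proof.
elim/loc_ind=> x; elim/loc_ind=> y; elim/loc_ind=> z.
by rewrite !loc_mulE; apply: mkloc_eq => /=; ring.
Qed.

Lemma loc_mulC : commutative loc_mul.
Proof.
elim/loc_ind=> x; elim/loc_ind=> y.
by rewrite !loc_mulE; apply: mkloc_eq => /=; ring.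
Qed.

Lemma loc_mul1 : left_id (mkloc (frac_of 1)) loc_mul.
Proof. by elim/loc_ind=> x; rewrite loc_mulE; apply: mkloc_eq => /=; ring. Qed.

Lemma loc_mul_linear y : linear (loc_mul^~ y).
Proof.
move=> c; elim/loc_ind=> u; elim/loc_ind=> v; elim/loc_ind: y => y.
change (loc_mul (loc_add (loc_scale c (mkloc u)) (mkloc v)) (mkloc y) =
  loc_add (loc_scale c (loc_mul (mkloc u) (mkloc y))) (loc_mul (mkloc v) (mkloc y))).
rewrite loc_scaleE loc_addE !loc_mulE loc_scaleE loc_addE.
have cE (a : A) : c *: a = (c *: (1 : A)) * a by rewrite -alg_scaleAl mul1r.
by apply: mkloc_eq => /=; rewrite (cE (num u)) (cE (num u * num y)); ring.
Qed.

Definition loc : comPzAlg k :=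
  @ComPzAlg k loc_mod _ _ loc_mulA loc_mulC loc_mul1 loc_mul_linear.

Definition loc_map (a : A) : loc := mkloc (frac_of a).
End Localization.

Section RotaBaxter.
Variable k : comPzRingType.

Definition alg_hom (B C : comPzAlg k) (f : B -> C) : Prop :=
  [/\ linear f, f 1 = 1 & {morph f : x y / x * y}].

(* Rota-Baxter operators of weight zero. *)
Definition rota_baxter (R : comPzAlg k) (P : R -> R) : Prop :=
  linear P /\ forall x y, P x * P y = P (x * P y + P x * y).

Definition rb_hom (R R' : comPzAlg k) (P : R -> R) (P' : R' -> R') (f : R -> R') :=
  alg_hom f /\ forall x, f (P x) = P' (f x).

Definition invertible (R : comPzAlg k) (x : R) : Prop := exists y : R, x * y = 1.

Definition inverts (R R' : comPzAlg k) (S : multSubset R) (f : R -> R') : Prop :=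
  forall s, mset S s -> invertible (f s).

(* (L, PL), together with i, is the Rota-Baxter localization of (R, P) at S. *)
Definition rb_localization (R : comPzAlg k) (P : R -> R) (S : multSubset R)
    (L : comPzAlg k) (PL : L -> L) (i : R -> L) : Prop :=
  [/\ rota_baxter PL, rb_hom P PL i, inverts S i &
    forall (R' : comPzAlg k) (P' : R' -> R') (f : R -> R'),
      rota_baxter P' -> rb_hom P P' f -> inverts S f ->
      exists! fS : L -> R', rb_hom PL P' fS /\ forall x, fS (i x) = f x].
End RotaBaxter.

(* Main.v *)
Require Import Defs.
From mathcomp Require Import all_boot all_order all_algebra.
From mathcomp Require Import boolp classical_sets.
From mathcomp Require Import ring.

(** Write [V = B / ker q] for a surjective linear map [q : B -> V] out of an
    algebra [B], and let [P_q] be the operator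
    [b (x) u_1 (x) ... (x) u_n |-> 1 (x) q b (x) u_1 (x) ... (x) u_n] on
    [sha B V].  The recursion defining the shuffle product is exactly the
    Rota-Baxter identity of weight zero, so [P_q] is a Rota-Baxter operator
    ([sha_op_rota_baxter]), and the inclusion of [B] sends [ker q] into
    [ker P_q].

    The pair [(sha B V, P_q)] is universal for this property
    ([sha_universal]): let [g : B -> R] be an algebra morphism into a
    Rota-Baxter algebra [(R, P)] with [P (g x) = 0] for [x] in [ker q].  A
    Rota-Baxter extension of [g] must send [b (x) q x_1 (x) ... (x) q x_n] to
    [g b * P (g x_1 * P (g x_2 * ... P (g x_n)))].  This iterated integral is
    multiplicative for the shuffle product, again by the Rota-Baxter identity,
    and it depends on the [x_i] only through the [q x_i]: if [P (g x) = 0],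
    then [0 = P (g x) * P y = P (g x * P y)], so that the integral vanishes as
    soon as some [x_i] lies in [ker q], whether [x_i] is the last letter or not
    ([iint_section]).

    For the localization, take [B = S^-1 A] and for [q] the projection modulo
    the image of [A].  A Rota-Baxter morphism [f] from [A] with the zero
    operator satisfies [P (f a) = 0]; if it inverts [S], it extends uniquely to
    an algebra morphism [g] on [S^-1 A] ([loc_extend], [loc_unique]), and
    [P \o g] vanishes on the image of [A].  The universal property of
    [sha B V] then is that of the Rota-Baxter localization.

    That [sha B V] is a quotient of [Sha B] and is isomorphic to the tensor
    product of [B] and the shuffle algebra holds for every linear [q], by
    comparing products of pure tensors ([sha_map_hom], [sha_tens_hom]). *)

Set Implicit Arguments.
Unset Strict Implicit.
Unset Printing Implicit Defensive.

Import GRing.Theory.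
Local Open Scope ring_scope.

(** * Linear maps and pure tensors *)

Lemma linD (k : comPzRingType) (U W : lmodType k) (f : U -> W) :
  linear f -> {morph f : x y / x + y}.
Proof. by move=> fL x y; have := fL 1 x y; rewrite !scale1r. Qed.

Lemma linZ (k : comPzRingType) (U W : lmodType k) (f : U -> W) c :
  linear f -> {morph f : x / c *: x}.
Proof. by move=> fL x; rewrite -[c *: x]addr0 fL (lin0 fL) addr0. Qed.

Lemma linB (k : comPzRingType) (U W : lmodType k) (f : U -> W) :
  linear f -> {morph f : x y / x - y}.
Proof.
by move=> fL x y; have := fL (-1) y x; rewrite !scaleN1r ![- _ + _]addrC.
Qed.

Lemma linear_comp (k : comPzRingType) (U V W : lmodType k)
    (f : V -> W) (g : U -> V) : linear f -> linear g -> linear (f \o g).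
Proof. by move=> fL gL c x y /=; rewrite gL fL. Qed.

Lemma linear_lincomb (k : comPzRingType) (U W : lmodType k) (f g : U -> W) (c : k) :
  linear f -> linear g -> linear (fun x => c *: f x + g x).
Proof.
by move=> fL gL a x y; rewrite fL gL !scalerDr !scalerA mulrC addrACA.
Qed.

Lemma shsum_map (T : Type) (U : Type) (W : nmodType) (h : T -> U)
    (Phi : seq U -> W) s t :
  shsum Phi (map h s) (map h t) = shsum (Phi \o map h) s t.
Proof.
elim: s t Phi => [|x s IHs] t Phi; first by rewrite !shsum0s.
elim: t Phi => [|y t IHt] Phi; first by rewrite !shsums0.
rewrite !map_cons !shsum_cons -[h y :: _]map_cons IHs -[h x :: _]map_cons.
by rewrite IHt.
Qed.

(** Both sides of the identity are linear in each variable, so [sha_ext],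
    applied to one variable after the other, reduces it to pure tensors. *)
Lemma sha_morphM (k : comPzRingType) (B C : comPzAlg k) (V : lmodType k)
    (f : sha B V -> C) : linear f ->
  (forall a u b v, f ((wpure a u : sha B V) * wpure b v) =
                   f (wpure a u) * f (wpure b v)) ->
  {morph f : x y / x * y}.
Proof.
move=> fL fM x y.
apply: (sha_ext (f := fun x : sha B V => f (x * y)) (g := fun x => f x * f y)).
- by move=> c u v; rewrite (alg_linl y) fL.
- by move=> c u v; rewrite fL (alg_linl (f y)).
move=> a u.
apply: (sha_ext (f := fun y : sha B V => f ((wpure a u : sha B V) * y))
                (g := fun y => f (wpure a u) * f y)) => //.
- by move=> c s t; rewrite (alg_linr (wpure a u : sha B V)) fL.
- by move=> c s t; rewrite fL (alg_linr (f _)).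
Qed.

Section ShaPure.
Variables (k : comPzRingType) (B : comPzAlg k) (V : lmodType k).

Lemma wpureM a u b v : (wpure a u : sha B V) * wpure b v =
  shsum (wpure (a * b)) u v.
Proof. exact: sha_mul_pure. Qed.

Lemma wpure_inl_hom : alg_hom (fun b : B => wpure b [::] : sha B V).
Proof.
split=> //; first exact: (proj1 (wpure_mlin B V) [::]).
by move=> x y; rewrite wpureM shsum0s.
Qed.

(** Linear maps out of the quotient by [Q] cannot distinguish the projection
    from the zero map when [Q] contains the pure tensors, hence the quotient
    vanishes. *)
Lemma sha_ind (Q : set (sha_mod B V)) : submodule Q ->
  (forall b u, Q (wpure b u)) -> forall y, Q y.
Proof.
move=> Qsub Qpure y; have piL := @lquot_pi_linear _ _ Q.
have : lquot_pi Q y = lquot_pi Q 0.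
  apply: (sha_ext (f := lquot_pi Q) (g := fun=> lquot_pi Q 0)) => // [c u v|b u].
    by rewrite (lin0 piL) scaler0 addr0.
  by apply/lquot_piP; rewrite subr0; apply: Defs.sub_span.
by move/lquot_piP; rewrite subr0; apply.
Qed.
End ShaPure.

(** * The quotient of Sha(B) *)

Section ShaMap.
Variables (k : comPzRingType) (B : comPzAlg k) (U V : lmodType k) (q : U -> V).
Hypothesis qL : linear q.

Definition sha_map : sha B U -> sha B V := wlift (fun b u => wpure b (map q u)).

Let word_mlin : mlin2 (fun (b : B) (u : seq U) => wpure b (map q u)).
Proof.
split=> [u|b u c x y w]; first exact: (proj1 (wpure_mlin B V)).
by rewrite !map_cat /= qL (proj2 (wpure_mlin B V)).
Qed.

Lemma sha_map_linear : linear sha_map.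
Proof. exact: wlift_linear word_mlin. Qed.

Lemma sha_map_pure b u : sha_map (wpure b u) = wpure b (map q u).
Proof. exact: wlift_pure word_mlin. Qed.

Lemma sha_map_hom : alg_hom sha_map.
Proof.
split; [exact: sha_map_linear | exact: sha_map_pure |].
apply: sha_morphM => [|a u b v]; first exact: sha_map_linear.
rewrite !wpureM !sha_map_pure wpureM shsum_map (lin_sum _ _ sha_map_linear).
by apply: eq_bigr => w _; rewrite sha_map_pure.
Qed.

Lemma sha_map_surj (r : V -> U) : cancel r q ->
  forall y, exists x, sha_map x = y.
Proof.
move=> rK; apply: sha_ind => [|b u].
  split=> [|c _ _ [x <-] [y <-]]; first by exists 0; exact: lin0 sha_map_linear.
  by exists (c *: x + y); rewrite sha_map_linear.
by exists (wpure b (map r u)); rewrite sha_map_pure mapK.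
Qed.
End ShaMap.

(** * The tensor product decomposition *)

Section ShaTens.
Variables (k : comPzRingType) (B : comPzAlg k) (V : lmodType k).

Definition sha_tens : sha B V -> tens_alg B (shuf V) :=
  wlift (fun b u => @tapure k B (shuf V) b (spure u)).

Definition tens_sha : tens_alg B (shuf V) -> sha B V :=
  tlift (fun (b : B) s => slift (wpure b) s).

Let word_mlin : mlin2 (fun (b : B) (u : seq V) => @tapure k B (shuf V) b (spure u)).
Proof.
split=> [u|b u c x y w]; first exact: tpure_linl.
by rewrite /tapure spure_mlin tpure_linr.
Qed.

Lemma sha_tens_linear : linear sha_tens.
Proof. exact: wlift_linear word_mlin. Qed.

Lemma sha_tens_pure b u :
  sha_tens (wpure b u) = @tapure k B (shuf V) b (spure u).
Proof. exact: wlift_pure word_mlin. Qed.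

Let slift_linl (s : shuf V) : linear (fun b : B => slift (wpure (V := V) b) s).
Proof.
have [wl wr] := wpure_mlin B V.
move=> c a b; have := shuf_ext (f := slift (wpure (V := V) (c *: a + b)))
  (g := fun s => c *: slift (wpure a) s + slift (wpure b) s).
apply; [exact: slift_linear | by apply: linear_lincomb; exact: slift_linear |].
by move=> u; rewrite !slift_pure //; exact: wl.
Qed.

Let slift_linr (b : B) : linear (slift (wpure (V := V) b)).
Proof. by apply: slift_linear; exact: (proj2 (wpure_mlin B V)). Qed.

Lemma tens_sha_linear : linear tens_sha.
Proof. exact: tlift_linear slift_linl slift_linr. Qed.

Lemma tens_sha_pure b u : tens_sha (@tapure k B (shuf V) b (spure u)) = wpure b u.
Proof.
rewrite /tens_sha (tlift_pure slift_linl slift_linr) slift_pure //.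
exact: (proj2 (wpure_mlin B V)).
Qed.

Lemma sha_tensK : cancel sha_tens tens_sha.
Proof.
apply: (sha_ext (f := tens_sha \o sha_tens) (g := id)) => //.
  exact: linear_comp tens_sha_linear sha_tens_linear.
by move=> b u /=; rewrite sha_tens_pure tens_sha_pure.
Qed.

Lemma tens_shaK : cancel tens_sha sha_tens.
Proof.
have cL := linear_comp sha_tens_linear tens_sha_linear.
apply: (tens_ext (f := sha_tens \o tens_sha) (g := id)) => // b.
apply: (shuf_ext (f := fun s => sha_tens (tens_sha (tpure b s))) (g := tpure b)).
- by move=> c x y; rewrite tpure_linr; exact: cL.
- exact: tpure_linr.
- by move=> u; rewrite -/(@tapure k B (shuf V) b (spure u)) tens_sha_pure sha_tens_pure.
Qed.

(** The product of [sha B V] multiplies the first factors and shuffles the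
    words independently, which is the product of the tensor algebra. *)
Lemma sha_tens_hom : alg_hom sha_tens.
Proof.
split; [exact: sha_tens_linear | exact: sha_tens_pure |].
apply: sha_morphM => [|a u b v]; first exact: sha_tens_linear.
rewrite wpureM !sha_tens_pure (lin_sum _ _ sha_tens_linear).
rewrite [RHS](@tens_mul_pure k B (shuf V)) [X in tapure _ X](shuf_mul_pure u v).
rewrite /tapure (lin_sum _ _ (tpure_linr _)).
by apply: eq_bigr => w _; rewrite sha_tens_pure.
Qed.
End ShaTens.

(** * The Rota-Baxter operator and its universal property *)

Section ShaOp.
Variables (k : comPzRingType) (B : comPzAlg k) (V : lmodType k) (q : B -> V).
Hypothesis qL : linear q.

(** This is the operator [x |-> 1 (x) x] of [Sha B] after the quotient: the
    first factor of a pure tensor becomes its second, where [q] applies. *)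
Definition sha_op : sha B V -> sha B V := wlift (fun b u => wpure 1 (q b :: u)).

Let word_mlin : mlin2 (fun (b : B) (u : seq V) => wpure (1 : B) (q b :: u)).
Proof.
have wr := proj2 (wpure_mlin B V) 1.
split=> [u c x y|b u]; first by rewrite qL; exact: (wr [::]).
exact: (wr (q b :: u)).
Qed.

Lemma sha_op_linear : linear sha_op.
Proof. exact: wlift_linear word_mlin. Qed.

Lemma sha_op_pure b u : sha_op (wpure b u) = wpure 1 (q b :: u).
Proof. exact: wlift_pure word_mlin. Qed.

(** On pure tensors this is the recursion of the shuffle product, according to
    which of the two words provides the first letter. *)
Lemma sha_op_rota_baxter : rota_baxter sha_op.
Proof.
split=> [|x y]; first exact: sha_op_linear.
have oL := sha_op_linear.
apply: (sha_ext (f := fun x : sha B V => sha_op x * sha_op y)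
  (g := fun x : sha B V => sha_op (x * sha_op y + sha_op x * y))).
- by move=> c s t; rewrite oL (alg_linl (sha_op y)).
- move=> c s t; rewrite (alg_linl (sha_op y)) oL (alg_linl y) -oL.
  by rewrite scalerDr addrACA.
move=> a u.
apply: (sha_ext (f := fun y : sha B V => sha_op (wpure a u) * sha_op y)
  (g := fun y : sha B V =>
     sha_op ((wpure a u : sha B V) * sha_op y + sha_op (wpure a u) * y))).
- by move=> c s t; rewrite oL (alg_linr (sha_op (wpure a u))).
- move=> c s t; rewrite oL (alg_linr (wpure a u : sha B V)).
  by rewrite (alg_linr (sha_op (wpure a u))) -oL scalerDr addrACA.
move=> b v; rewrite !sha_op_pure !wpureM !mulr1 mul1r shsum_cons (linD oL).
by rewrite !(lin_sum _ _ oL); congr (_ + _); apply: eq_bigr => w _; rewrite sha_op_pure.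
Qed.

Section Universal.
Variables (r : V -> B) (R : comPzAlg k) (P : R -> R) (g : B -> R).
Hypotheses (rK : cancel r q) (PRB : rota_baxter P) (gH : alg_hom g).
Hypothesis Pg0 : forall x, q x = 0 -> P (g x) = 0.

(** The iterated integral [P (g x_1 * P (g x_2 * ... P (g x_n)))], where the
    [x_i] are the lifts of the letters chosen by the section [r] of [q]; by
    [iint_section] any other lifts give the same value. *)
Fixpoint iint (u : seq V) : R :=
  if u is v :: u' then P (g (r v) * iint u') else 1.

(** The letter [q x] may be integrated through any of its lifts: for [z] in
    the kernel of [q], the Rota-Baxter identity for [P (g z) * P y = 0] reads
    [P (g z * P y) = 0], and an iterated integral is either [1] or in the
    image of [P]. *)
Lemma iint_section x u : iint (q x :: u) = P (g x * iint u).
Proof.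
have [PL PM] := PRB; have [gL _ _] := gH.
pose z := r (q x) - x.
have qz : q z = 0 by rewrite linB // rK subrr.
have E : P (g z * iint u) = 0.
  case: u => [|v u] /=; first by rewrite mulr1 Pg0.
  have := PM (g z) (g (r v) * iint u).
  by rewrite Pg0 // !mul0r addr0.
apply/eqP; rewrite -subr_eq0 /= -linB // -mulrBl -linB //.
by apply/eqP.
Qed.

Lemma iint_mlin : mlin iint.
Proof.
have [PL _] := PRB; have [gL _ _] := gH.
move=> u c x y w; elim: u => [|v u IHu].
  rewrite !cat0s -(rK x) -(rK y) -qL !iint_section gL.
  by rewrite (alg_linl (iint w)) PL.
by rewrite !cat_cons /= IHu (alg_linr (g _)) PL.
Qed.

(** Both sides satisfy the same recursion on the first letters, by the
    Rota-Baxter identity of [P]. *)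
Lemma iintM u v : iint u * iint v = shsum iint u v.
Proof.
have [PL PM] := PRB.
elim: u v => [|x u IHu] v; first by rewrite mul1r shsum0s.
elim: v => [|y v IHv]; first by rewrite mulr1 shsums0.
have E z s t : P (g (r z) * shsum iint s t) = shsum (fun w => iint (z :: w)) s t.
  rewrite [g (r z) * _](lin_sum _ _ (alg_linr (g (r z)))).
  by rewrite (lin_sum _ _ PL).
rewrite shsum_cons -!E -IHu -IHv /= PM -linD //; congr P; ring.
Qed.

Definition sha_extend : sha B V -> R := wlift (fun b u => g b * iint u).

Let integral_mlin : mlin2 (fun (b : B) (u : seq V) => g b * iint u).
Proof.
have [gL _ _] := gH.
split=> [u c x y|b u c x y w]; first by rewrite gL (alg_linl (iint u)).
by rewrite iint_mlin (alg_linr (g b)).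
Qed.

Lemma sha_extend_linear : linear sha_extend.
Proof. exact: wlift_linear integral_mlin. Qed.

Lemma sha_extend_pure b u : sha_extend (wpure b u) = g b * iint u.
Proof. exact: wlift_pure integral_mlin. Qed.

Lemma sha_extend_hom : rb_hom sha_op P sha_extend.
Proof.
have [PL PM] := PRB; have [gL g1 gM] := gH; split.
  split; first exact: sha_extend_linear.
    by rewrite [1]/(wpure 1 [::]) sha_extend_pure g1 mulr1.
  apply: sha_morphM => [|a u b v]; first exact: sha_extend_linear.
  rewrite wpureM !sha_extend_pure (lin_sum _ _ sha_extend_linear) mulrACA -gM iintM.
  rewrite [RHS](lin_sum _ _ (alg_linr (g (a * b)))).
  by apply: eq_bigr => w _; rewrite sha_extend_pure.
apply: (sha_ext (f := sha_extend \o sha_op) (g := P \o sha_extend)).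
- exact: linear_comp sha_extend_linear sha_op_linear.
- exact: linear_comp PL sha_extend_linear.
- by move=> b u /=; rewrite sha_op_pure !sha_extend_pure iint_section g1 mul1r.
Qed.

Lemma sha_extend_inl b : sha_extend (wpure b [::]) = g b.
Proof. by rewrite sha_extend_pure mulr1. Qed.

(** A pure tensor is [b] times an iterated application of [sha_op] to elements
    of [B], so its image is forced. *)
Lemma sha_extend_unique (h : sha B V -> R) : rb_hom sha_op P h ->
  (forall b, h (wpure b [::]) = g b) -> sha_extend =1 h.
Proof.
case=> [[hL h1 hM] hP] hg; have [PL PM] := PRB.
have wE b u : wpure b u = (wpure b [::] : sha B V) * wpure 1 u.
  by rewrite wpureM shsum0s mulr1.
apply: sha_ext => // [|b u]; first exact: sha_extend_linear.
rewrite sha_extend_pure wE hM hg; congr (_ * _).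
elim: u => [|v u IHu] /=; first exact/esym/h1.
by rewrite -{2}(rK v) -sha_op_pure hP wE hM hg IHu.
Qed.

(** With [q] injective this is the freeness of [Sha B]; a kernel of [q] amounts
    to the relations [P (g x) = 0]. *)
Lemma sha_universal :
  exists! h, rb_hom sha_op P h /\ forall b, h (wpure b [::]) = g b.
Proof.
exists sha_extend; split=> [|h [hH hg]].
  by split; [exact: sha_extend_hom | exact: sha_extend_inl].
by apply: functional_extensionality_dep; exact: sha_extend_unique.
Qed.
End Universal.
End ShaOp.

(** * Localization of algebras *)

Section LocUniversal.
Variables (k : comPzRingType) (A : comPzAlg k) (S : multSubset A).

Lemma mklocM (x y : Defs.frac S) :
  (mkloc x : loc S) * mkloc y = mkloc (frac_mul x y).
Proof. exact: loc_mulE. Qed.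

Lemma loc_map_hom : alg_hom (loc_map S).
Proof.
split=> // [c x y|x y]; last by rewrite mklocM; apply: mkloc_eq => /=; ring.
change (mkloc (frac_of S (c *: x + y)) =
  loc_add (loc_scale c (mkloc (frac_of S x))) (mkloc (frac_of S y))).
by rewrite loc_scaleE loc_addE; apply: mkloc_eq => /=; ring.
Qed.

Lemma loc_map_inverts : inverts S (loc_map S).
Proof.
move=> s Ss; exists (mkloc (Frac 1 Ss)); rewrite mklocM.
by apply: mkloc_eq => /=; ring.
Qed.

Lemma loc_den (x : Defs.frac S) :
  (mkloc x : loc S) * loc_map S (den x) = loc_map S (num x).
Proof. by rewrite mklocM; apply: mkloc_eq => /=; ring. Qed.

Lemma invertible_cancel (R : comPzAlg k) (z x y : R) :
  invertible z -> x * z = y * z -> x = y.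
Proof.
by case=> t zt e; rewrite -[x]mulr1 -[y]mulr1 -zt !mulrA e.
Qed.

(** A fraction times its denominator comes from [A], and the image of the
    denominator is invertible. *)
Lemma loc_unique (R : comPzAlg k) (g h : loc S -> R) :
  alg_hom g -> alg_hom h -> inverts S (g \o loc_map S) ->
  (forall a, g (loc_map S a) = h (loc_map S a)) -> g =1 h.
Proof.
move=> [_ _ gM] [_ _ hM] inv gh; elim/loc_ind => x.
apply: (invertible_cancel (inv _ (denP x))) => /=.
by rewrite -gM gh -hM !loc_den gh.
Qed.

Lemma loc_extend (R : comPzAlg k) (f : A -> R) : alg_hom f -> inverts S f ->
  exists g : loc S -> R, alg_hom g /\ forall a, g (loc_map S a) = f a.
Proof.
move=> [fL f1 fM] inv.
have /boolp.choice[j jP] : forall x : Defs.frac S, exists y, f (den x) * y = 1.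
  by move=> x; exact: inv (denP x).
pose g (x : loc S) := f (num (loc_repr x)) * j (loc_repr x).
(* The value of [g] at a fraction does not depend on its representative:
   the image of the denominator can be cancelled in this equation. *)
have gE x : g (mkloc x) * f (den x) = f (num x).
  have [t St e] := loc_repr_mk x; rewrite /g; set y := loc_repr _ in e *.
  apply: (invertible_cancel (inv _ (denP y))).
  apply: (invertible_cancel (inv _ St)).
  transitivity (f (t * (num y * den x)) * (f (den y) * j y)).
    by rewrite !fM; ring.
  by rewrite e jP !fM; ring.
have g_eq x z : z * f (den x) = f (num x) -> g (mkloc x) = z.
  by rewrite -gE => /esym; apply: invertible_cancel; exact: inv (denP x).
exists g; split=> [|a]; last by apply: g_eq; rewrite f1 mulr1.
split=> [c||].
- elim/loc_ind => x; elim/loc_ind => y.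
  change (g (loc_add (loc_scale c (mkloc x)) (mkloc y)) =
    c *: g (mkloc x) + g (mkloc y)).
  rewrite loc_scaleE loc_addE; apply: g_eq => /=.
  rewrite (linD fL) !fM (linZ _ fL) -!gE mulrDl -!alg_scaleAl mulrA.
  by congr (_ + _); ring.
- by apply: g_eq; rewrite f1 mulr1.
- elim/loc_ind => x; elim/loc_ind => y; rewrite mklocM; apply: g_eq => /=.
  by rewrite !fM -!gE; ring.
Qed.
End LocUniversal.

(** * Rota-Baxter localization *)

Theorem theorem3p5 (k : comPzRingType) (A : comPzAlg k) (S : multSubset A) :
  let L : comPzAlg k := loc S in
  let V : lmodType k := lquot (range (@loc_map k A S) : set L) in
  let q : L -> V := @lquot_pi k L _ in
  let M : comPzAlg k := sha L V in
  [/\ exists pi : Sha L -> M,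
        [/\ alg_hom pi,
            forall y : M, exists x : Sha L, pi x = y
          & forall (a : L) (u : seq L), pi (wpure a u) = wpure a (map q u)],
      exists P : M -> M,
        rb_localization (fun _ : A => 0) S P (fun a : A => wpure (loc_map S a) [::])
    & exists phi : M -> tens_alg L (shuf V),
        [/\ alg_hom phi, bijective phi
          & forall (a : L) (u : seq V), phi (wpure a u) = @tapure k L (shuf V) a (spure u)]].
Proof.
move=> L V q M.
have qL : linear q by exact: lquot_pi_linear.
have qK : cancel (@lquot_repr k L _ : V -> L) q by exact: lquot_reprK.
have q0 a : q (loc_map S a) = 0.
  rewrite -(lin0 qL); apply/lquot_piP; rewrite subr0.
  by apply: Defs.sub_span; exists a.
have [lL l1 lM] := loc_map_hom S; have [iL i1 iM] := wpure_inl_hom L V.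
split.
- exists (sha_map q); split; [exact: sha_map_hom | exact: sha_map_surj qK |].
  exact: sha_map_pure.
- exists (sha_op q); split; first exact: sha_op_rota_baxter.
  + (* [1 (x) q a = 0] for [a] in [A]: the inclusion intertwines 0 and [P]. *)
    split; first split.
    * exact: linear_comp iL lL.
    * by rewrite l1.
    * by move=> x y; rewrite lM iM.
    move=> a; rewrite (lin0 lL) (lin0 iL) sha_op_pure // q0.
    by have := lin0 (fun c x y => proj2 (wpure_mlin L V) 1 [::] c x y [::]).
  + move=> s /loc_map_inverts[t st]; exists (wpure t [::]).
    by rewrite -iM st.
  move=> R P f PRB [fH fP] finv; have [g [gH gf]] := loc_extend fH finv.
  have [[PL _] [gL _ _] [fL _ _]] := And3 PRB gH fH.
  have Pg0 x : q x = 0 -> P (g x) = 0.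
    (* [P \o g] is linear and vanishes on the generators of the kernel of [q],
       where it equals [P \o f = f \o 0]. *)
    rewrite -(lin0 qL) => /lquot_piP; rewrite subr0.
    apply: (linear_span_eq (linear_comp PL gL)) => _ [a _ <-] /=.
    by rewrite gf -fP (lin0 fL).
  have [h [[hH hg] hU]] := sha_universal qL qK PRB gH Pg0.
  exists h; split=> [|h' [h'H h'f]].
    by split=> // a; rewrite hg gf.
  apply: hU; split=> // b; have [[h'L h'1 h'M] _] := h'H.
  apply: (loc_unique (S := S) (g := fun b : L => h' (wpure b [::])) (h := g)) => //.
  + split; [exact: linear_comp h'L iL | exact: h'1 |].
    by move=> x y; rewrite iM h'M.
  + by move=> s Ss /=; rewrite h'f; exact: finv.
  + by move=> a; rewrite h'f gf.
- exists (@sha_tens k L V); split; [exact: sha_tens_hom | | exact: sha_tens_pure].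
  exact: Bijective (@sha_tensK _ _ _) (@tens_shaK _ _ _).
Qed.
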